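(* Let $\lambda=(a,a)$ be a partition of $n=2a\ge3$. If $\Gamma$ is a (reduced) nb-admissible $\overline{\mathcal S_n}$-graph such that $U(\Gamma)\simeq\overline{\mathcal D}_\lambda$ and there exists an embedding from $\overline\Gamma_\lambda$ to $\Gamma$, then this embedding is an isomorphism.
   Context: **Conventions.** For $k\in\mathbb Z$, $\overline{k}$ is the unique element of $\{1,\dots,n\}$ congruent to $k$ modulo $n$; $[1,n]=\{1,\dots,n\}$. For $a',b'\in[1,n]$, $\langle a',b'\rangle$ is $\emptyset$ if $a'=\overline{b'+1}$, and otherwise the cyclic interval $\{a',\overline{a'+1},\dots,b'\}$. $\overline{\mathcal S_n}$ is the affine symmetric group, a Coxeter group with simple reflections $s_0=s_n,s_1,\dots,s_{n-1}$ (type $\widetilde A_{n-1}$), identified with $[1,n]$ via $s_i\leftrightarrow i$. **Tableaux.** $\mathrm{RSYT}(\lambda)$ is the set of fillings of the Young diagram of $\lambda$ (English convention) by $1,\dots,n$, each used once, with rows increasing; $T^1$ (top row), $T^2$ are the rows of $T$, regarded as sets. Interchanging entries is followed by re-sorting rows. $\overline{\mathrm{des}}(T)=\{i\in[1,n]\mid i\text{ lies in a strictly higher row of }T\text{ than }\overline{i+1}\}$. $T,T'$ are connected by a Knuth move if $\overline{\mathrm{des}}(T),\overline{\mathrm{des}}(T')$ are incomparable under inclusion and $T'$ is obtained from $T$ by interchanging $\overline i$ and $\overline{i+1}$ for some $i$. **Labeled graphs and $W$-graphs.** For a Coxeter group $W$ with simple reflections $I$, an $I$-labeled graph $(V,m,\tau)$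 consists of a set $V$, maps $m:V\times V\to\mathbb Z[q^{\pm1/2}]$ (written $m(u\triangleright v)$) and $\tau:V\to\{\text{subsets of }I\}$, such that for each $v$ only finitely many $w$ have $m(v\triangleright w)\ne0$ or $m(w\triangleright v)\neq0$. It is reduced if $m(u\triangleright v)=0$ whenever $\tau(u)\subset\tau(v)$. It is nb-admissible if all $m(u\triangleright v)\in\mathbb N=\{0,1,2,\dots\}$ and $m(u\triangleright v)=m(v\triangleright u)$ whenever $\tau(u),\tau(v)$ are incomparable. Let $\mathcal H_W$ be the Iwahori–Hecke algebra over $\mathbb Z[q^{\pm1/2}]$ with generators $T_i$ ($i\in I$) satisfying the braid relations and $(T_i-q)(T_i+1)=0$. The graph is a $W$-graph if the formulas $T_i(u)=qu$ if $i\notin\tau(u)$, and $T_i(u)=-u+q^{1/2}\sum_{v:\,i\notin\tau(v)}m(u\triangleright v)\,v$ if $i\in\tau(u)$, define an $\mathcal H_W$-module structure on $\bigoplus_{v\in V}\mathbb Z[q^{\pm1/2}]v$. The simple underlying graph $U(\Gamma)$ has the same $V,\tau$, and weight $m'$ with $m'(u\triangleright v)=m'(v\triangleright u)=1$ if $m(u\triangleright v)=m(v\triangleright u)=1$, and $m'(u\triangleright v)=m'(v\triangleright u)=0$ otherwise. Isomorphisms are bijections of vertices preserving $m$ and $\tau$. A subgraph of $(V',m',\tau')$ is $(V'',m'',\tau'')$ with $V''\subset V'$, $\tau''=\tau'|_{V''}$, $m''(u\triangleright v)\in\{m'(u\triangleright v),0\}$; an embedding $\Gamma\to\Gamma'$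 is an isomorphism of $\Gamma$ onto a subgraph of $\Gamma'$. **The graph $\overline{\mathcal D}_\lambda$.** Vertex set $\mathrm{RSYT}(\lambda)$, $\tau=\overline{\mathrm{des}}$, $m(u\triangleright v)=m(v\triangleright u)=1$ if $u,v$ are connected by a Knuth move, $0$ otherwise. **The graph $\overline\Gamma_\lambda$.** The $[1,n]$-labeled graph $(\mathrm{RSYT}(\lambda),m,\overline{\mathrm{des}})$ with $m\in\{0,1\}$ and $m(s\triangleright t)=1$ iff: (first kind) $t$ is obtained from $s$ by interchanging $\overline i\in s^1$ and $\overline{i+1}\in s^2$; or (second kind) $t$ is obtained from $s$ by interchanging $\overline i\in s^2$ and $\overline j\in s^1$, $\overline i\ne\overline{j+1}$, where $\overline{j-i}$ is odd; $\overline{i+1}\in s^1$ and $\overline{j-1}\in s^2$; $\overline{i-1}\in s^1$ or $\overline{j+1}\in s^2$; $\#(s^2\cap\langle\overline{j-1-2k},\overline{j-2}\rangle)\ge k$ for $k\in\{1,\dots,\frac{\overline{j-i}-3}2\}$; and $\#(s^2\cap\langle\overline{i+2},\overline{j-2}\rangle)=\frac{\overline{j-i}-3}2$ when $\overline j\neq\overline{i+1}$. *)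

(* Defs.v *)
From HB Require Import structures.
From mathcomp Require Import all_boot all_algebra perm fraction.
From mathcomp Require Import finmap.
From mathcomp Require Import monalg.
From mathcomp Require Import boolp classical_sets cardinality fsbigop.

Set Implicit Arguments.
Unset Strict Implicit.
Unset Printing Implicit Defensive.

Import GRing.Theory.
Local Open Scope ring_scope.
Local Notation "x %:F" := (tofrac x) : ring_scope.

(** * The ring Z[q^{1/2}, q^{-1/2}] *)

(* With X standing for q^{1/2}: the fractions f in Z(X) such that X^k f is a
   polynomial for some k. *)
Definition laurent_pred : {pred {fraction {poly int}}} :=
  fun f => `[< exists (k : nat) (p : {poly int}), f * 'X^k%:F = p%:F >].

Fact laurent_subring_closed : subring_closed laurent_pred.
Proof.
split=> [|f g /asboolP[k [p Hf]] /asboolP[l [r Hg]]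
         |f g /asboolP[k [p Hf]] /asboolP[l [r Hg]]]; apply/asboolP.
- by exists 0%N, 1; rewrite expr0 mul1r.
- exists (k + l)%N, (p * 'X^l - r * 'X^k).
  rewrite tofracB !tofracM -Hf -Hg exprD tofracM mulrBl !mulrA.
  by congr (_ - _); rewrite -!mulrA; congr (_ * _); rewrite mulrC.
- exists (k + l)%N, (p * r).
  by rewrite tofracM -Hf -Hg exprD tofracM mulrACA.
Qed.

HB.instance Definition _ :=
  GRing.isSubringClosed.Build {fraction {poly int}} laurent_pred
    laurent_subring_closed.

Record laurent : predArgType := Laurent {
  laurent_val : {fraction {poly int}};
  laurent_valP : laurent_val \in laurent_pred }.

HB.instance Definition _ := [isSub for laurent_val].
HB.instance Definition _ := [Choice of laurent by <:].
HB.instance Definition _ := [SubChoice_isSubComNzRing of laurent by <:].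

Fact qhalf_subproof : 'X%:F \in laurent_pred.
Proof. by apply/asboolP; exists 0%N, 'X; rewrite expr0 mulr1. Qed.

Definition qhalf : laurent := Laurent qhalf_subproof.
Definition qvar : laurent := qhalf ^+ 2.

(** * Labeled graphs *)

Record lgraph (I : finType) := LGraph {
  vert :> choiceType;
  wt : vert -> vert -> laurent;
  tau : vert -> {set I};
  wt_fin : forall v : vert,
    finite_set [set w : vert | wt v w <> 0 \/ wt w v <> 0]%classic }.

Arguments wt {I} l _ _.
Arguments tau {I} l _.

Section LabeledGraphs.
Variable I : finType.
Implicit Types G H : lgraph I.

Definition incomparable (A B : {set I}) : bool :=
  ~~ (A \subset B) && ~~ (B \subset A).

Definition reduced G : Prop :=
  forall u v : G, tau G u \subset tau G v -> wt G u v = 0.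

Definition nb_admissible G : Prop :=
  (forall u v : G, exists k : nat, wt G u v = k%:R) /\
  (forall u v : G, incomparable (tau G u) (tau G v) -> wt G u v = wt G v u).

Definition is_iso G H (f : G -> H) : Prop :=
  [/\ bijective f, forall u, tau H (f u) = tau G u &
      forall u v, wt H (f u) (f v) = wt G u v].

Definition isomorphic G H : Prop := exists f : G -> H, is_iso f.

(* [f] is an isomorphism onto the subgraph of [H] with vertex set the image of
   [f] whose weights are those of [G], each of which is the weight in [H] or
   zero. *)
Definition is_embedding G H (f : G -> H) : Prop :=
  [/\ injective f, forall u, tau H (f u) = tau G u &
      forall u v, wt G u v = wt H (f u) (f v) \/ wt G u v = 0].

Definition ugraph_wt G (u v : G) : laurent :=
  if (wt G u v == 1) && (wt G v u == 1) then 1 else 0.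

Fact indic_neq0 (R : nzRingType) (x y : R) :
  (if (x == 1) && (y == 1) then 1 else 0) <> 0 :> R -> x <> 0 /\ y <> 0.
Proof.
case: ifP => [/andP[/eqP-> /eqP->] _|_ []//].
by split; apply/eqP; rewrite oner_eq0.
Qed.

Fact ugraph_fin G (v : G) :
  finite_set
    [set w : G | ugraph_wt v w <> 0 \/ ugraph_wt w v <> 0]%classic.
Proof.
apply: sub_finite_set (wt_fin v) => w /= -[] /indic_neq0[neq0 neq0'];
  by left.
Qed.

Definition ugraph G : lgraph I := LGraph (tau G) (@ugraph_fin G).

(** * Iwahori-Hecke algebras and W-graphs *)

Section Hecke.

(* Coxeter matrix of (W, I), with 0 standing for an infinite order. *)
Variable cox : I -> I -> nat.

(* The product f g f ... with k factors. *)
Fixpoint altprod (M : Type) (k : nat) (f g : M -> M) : M -> M :=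
  if k is k'.+1 then f \o altprod k' g f else id.

(* The Hecke algebra is presented by the generators T_i subject to the braid
   and quadratic relations, so a module structure is the same as linear operators
   [T i] satisfying these relations. When [cox i j = 0] the braid relation
   below reads id = id, i.e. there is none. *)
Definition hecke_module (M : lmodType laurent) (T : I -> M -> M) : Prop :=
  [/\ forall i, linear (T i),
      forall i j, i != j ->
        altprod (cox i j) (T i) (T j) =1 altprod (cox i j) (T j) (T i) &
      forall i x, let y := T i x + x in T i y - qvar *: y = 0].

Definition hecke_gen G (i : I) (u : G) : {malg laurent[G]} :=
  if i \in tau G u
  then - << u >> + qhalf *:
         \sum_(v \in [set v : G | i \notin tau G v]%classic) wt G u v *: << v >>
  else qvar *: << u >>.

Definition hecke_op G (i : I) (x : {malg laurent[G]}) : {malg laurent[G]} :=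
  \sum_(u <- msupp x) x@_u *: hecke_gen i u.

Definition wgraph G : Prop := hecke_module (@hecke_op G).

End Hecke.

End LabeledGraphs.

(** * The affine symmetric group *)

(* From here on [1,n] is encoded as 'Z_n (for n >= 2), the class of k being
   \overline{k}; in particular n is encoded as 0, so that s_0 = s_n. *)

(* The Coxeter matrix of type \tilde A_{n-1}, n >= 3. *)
Definition cox_affA (n : nat) (i j : 'Z_n) : nat :=
  if i == j then 1 else if (j == i + 1) || (i == j + 1) then 3 else 2.

(* The representative of x in {1, ..., n}. *)
Definition rep (n : nat) (x : 'Z_n) : nat :=
  if x == 0 then n else nat_of_ord x.

Definition cyc_interval (n : nat) (a b : 'Z_n) : {set 'Z_n} :=
  if a == b + 1 then finset.set0
  else [set x : 'Z_n | (nat_of_ord (x - a)%R <= nat_of_ord (b - a)%R)%N]%SET.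

(** * Tableaux *)

Definition cell (la : seq nat) : finType :=
  {r : 'I_(size la) & 'I_(nth 0%N la r)}.

Section Tableaux.
Variables (n : nat) (la : seq nat).

Definition is_rsyt (T : {ffun cell la -> 'Z_n}) : bool :=
  [forall x : 'Z_n, #|[pred c | T c == x]| == 1%N] &&
  [forall r : 'I_(size la), forall c : 'I_(nth 0%N la r),
     forall d : 'I_(nth 0%N la r),
     (c < d)%N ==> (rep (T (Tagged _ c)) < rep (T (Tagged _ d)))%N].

Definition RSYT : finType := {T : {ffun cell la -> 'Z_n} | is_rsyt T}.

Implicit Types s t : RSYT.

(* The set of entries of row r; rows are numbered from 0. *)
Definition trow s (r : nat) : {set 'Z_n} :=
  [set val s c | c : cell la & tag c == r :> nat]%SET.

(* t is obtained from s by interchanging the entries x and y and re-sorting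
   rows. *)
Definition interchanged (x y : 'Z_n) s t : bool :=
  [forall r : 'I_(size la), trow t r == [set tperm x y z | z in trow s r]%SET].

Definition desbar s : {set 'Z_n} :=
  [set i : 'Z_n | [exists r1 : 'I_(size la), exists r2 : 'I_(size la),
    [&& (r1 < r2)%N, i \in trow s r1 & i + 1 \in trow s r2]]]%SET.

Definition knuth_move s t : bool :=
  incomparable (desbar s) (desbar t) &&
  [exists i : 'Z_n, interchanged i (i + 1) s t].

Fact fin_vertex_fin (m : RSYT -> RSYT -> laurent) s :
  finite_set [set t : RSYT | m s t <> 0 \/ m t s <> 0]%classic.
Proof. exact: finite_finset. Qed.

Definition Dgraph : lgraph 'Z_n :=
  LGraph desbar
    (fin_vertex_fin (fun s t => if knuth_move s t then 1 else 0)).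

(* The shape is assumed to have two rows, s^1 being [trow s 0] and s^2 being
   [trow s 1]. In [second_kind], d = \overline{j-i}, and h = (d-3)/2 is
   truncated to 0 when d = 1, where the two conditions involving h are void. *)
Definition first_kind s t : bool :=
  [exists i : 'Z_n,
    [&& i \in trow s 0, i + 1 \in trow s 1 & interchanged i (i + 1) s t]].

Definition second_kind s t : bool :=
  [exists i : 'Z_n, exists j : 'Z_n,
    let d := rep (j - i) in
    let h := ((d - 3) %/ 2)%N in
    [&& i \in trow s 1, j \in trow s 0, interchanged i j s t,
        i != j + 1, odd d, i + 1 \in trow s 0, j - 1 \in trow s 1,
        (i - 1 \in trow s 0) || (j + 1 \in trow s 1),
        [forall k : 'I_h.+1, (0 < k)%N ==>
           (k <= #|trow s 1 :&: cyc_interval (j - 1 - (2 * k)%:R)%R (j - 2)%R|)%N] &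
        (j != i + 1) ==> (#|trow s 1 :&: cyc_interval (i + 2) (j - 2)| == h)]].

Definition Gammagraph : lgraph 'Z_n :=
  LGraph desbar
    (fin_vertex_fin
       (fun s t => if first_kind s t || second_kind s t then 1 else 0)).

End Tableaux.

(* Main.v *)
(* Write a vertex as a cyclic word, [+] at the positions in the top row and [-]
   at those in the bottom row, so that a descent is a factor [+-]. For a vertex
   [v] and [i] not a descent of [v], let [N_i(v)] be the sum of the weights
   [m(u, v)] over all [u] having [i] as a descent. The graph \overline\Gamma
   already contributes an edge to [N_i(v)], so everything follows from
   [N_i(v) <= 1].
   If [i - 1] or [i + 1] is a descent of [v], this comes from the braid relation
   and positivity. In general, a Knuth move [v -> v'] which happens away from
   [i - 1], [i], [i + 1] gives, via the commutation relations,
   [N_i(v) <= 1] as soon as [N_i(v') <= 1]. Such moves on the word read on the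
   positions [i + 2, ..., i - 1] push the minus signs towards [i + 2]; when none
   is left, [i - 1] or [i + 1] is a descent, or the word read from [i] is
   [-+(+-)...(+-)]. In the last case commutation forces the descents
   [i, i + 2, i + 4, ...] on every [u] contributing to [N_i(v)], so [u] is the
   alternating word. *)

From HB Require Import structures.
Require Import Defs.
From mathcomp Require Import finmap monalg.
From mathcomp Require Import boolp classical_sets cardinality fsbigop.
From mathcomp Require Import all_boot all_algebra perm fraction zify.

Set Implicit Arguments.
Unset Strict Implicit.
Unset Printing Implicit Defensive.

Import GRing.Theory.
Local Open Scope ring_scope.

(** * Relations between the weights of a W-graph *)

Lemma laurent_natr_inj (k l : nat) : k%:R = l%:R :> laurent -> k = l.
Proof.
move=> /(congr1 val); rewrite !rmorph_nat => /eqP.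
rewrite -!(rmorph_nat (@tofrac {poly int})) tofrac_eq => /eqP.
move=> /(congr1 (fun p : {poly int} => p`_0)).
by rewrite -!polyC_natr !coefC !eqxx /= !natz => -[].
Qed.

Lemma laurent_mulI (c x : laurent) : val c != 0 -> c * x = 0 -> x = 0.
Proof.
move=> c0 /(congr1 val); rewrite rmorphM rmorph0 => /eqP.
by rewrite mulf_eq0 (negPf c0) /= => /eqP ?; apply: val_inj; rewrite rmorph0.
Qed.

Lemma qhalf_neq0 : val qhalf != 0.
Proof. by rewrite /= tofrac_eq0 polyX_eq0. Qed.

Lemma qvar1_neq0 : val (qvar + 1) != 0.
Proof.
rewrite rmorphD rmorphXn rmorph1 /= -tofracXn -tofrac1 -tofracD tofrac_eq0.
by rewrite -size_poly_eq0 size_XnaddC.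
Qed.

Lemma laurent_opp_eq_qvar (y : laurent) : - y = qvar * y -> y = 0.
Proof.
move=> /eqP; rewrite eq_sym -subr_eq0 opprK => /eqP E.
by apply: (laurent_mulI qvar1_neq0); rewrite mulrDl mul1r.
Qed.

Lemma qvar_natr_inj (k l : nat) :
  qvar * k%:R = qvar * l%:R :> laurent -> k = l.
Proof.
move=> /eqP; rewrite -subr_eq0 -mulrBr => /eqP; rewrite /qvar expr2 -mulrA.
move=> /(laurent_mulI qhalf_neq0)/(laurent_mulI qhalf_neq0)/eqP.
by rewrite subr_eq0 => /eqP/laurent_natr_inj.
Qed.

(** For sums over the support of a module element: vertices outside the support contribute zero, so
    the sum can run over the finite type [V] that indexes all vertices. *)
Lemma sum_seq_bij (V : finType) (K : choiceType) (f : V -> K) (R : nmodType)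
    (s : seq K) (F : K -> R) :
  bijective f -> uniq s -> (forall x, x \notin s -> F x = 0) ->
  \sum_(x <- s) F x = \sum_(w : V) F (f w).
Proof.
move=> [g fK gK] us F0.
rewrite -big_enum -(big_map f xpredT F) [RHS](bigID (fun x => x \in s)) /=.
rewrite [X in _ + X]big1 ?addr0 // -[RHS]big_filter; apply: perm_big.
apply: uniq_perm => // [|x].
  by apply: filter_uniq; rewrite map_inj_uniq ?enum_uniq //; apply: can_inj fK.
rewrite mem_filter; case: (x \in s) => //=; symmetry.
by apply/mapP; exists (g x); rewrite ?gK ?mem_enum.
Qed.

Section HeckeRelations.
Variables (I : finType) (cox : I -> I -> nat) (G : lgraph I).
Variables (V : finType) (f : V -> G).
Hypotheses (hW : wgraph cox G) (fbij : bijective f).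

Lemma hecke_genE i (u v : G) :
  (hecke_gen i u)@_v =
  if i \in tau G u
  then - (u == v)%:R + (if i \in tau G v then 0 else qhalf * wt G u v)
  else qvar * (u == v)%:R.
Proof.
rewrite /hecke_gen; case: ifP => _; last by rewrite mcoeffZ mcoeffU.
rewrite mcoeffD mcoeffN. rewrite mcoeffU mcoeffZ; congr (_ + _).
set A := [set w | _]%classic.
(* The sum in [hecke_gen] runs over a classical set; its finiteness, inherited from [V], turns it
   into an ordinary finite sum. *)
have finA : finite_set A.
  apply: (@sub_finite_set _ _ (f @` [set: V])%classic).
    by case: fbij => g _ gK w _; exists (g w); rewrite ?gK.
  exact/finite_image/finite_finset.
have inA : (v \in fset_set A) = (i \notin tau G v).
  by rewrite in_fset_set //; apply/idP/idP; rewrite in_setE.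
rewrite fsbig_finite //= raddf_sum /=.
under eq_bigr => x _ do rewrite mcoeffZ mcoeffU.
case: ifPn => [iv | niv].
  rewrite big_seq big1 ?mulr0 // => x xA.
  case: eqP => [xv|]; last by rewrite mulr0.
  by move: xA; rewrite xv inA iv.
rewrite (bigD1_seq v) ?inA ?fset_uniq //= eqxx mulr1 big1 ?addr0 //.
by move=> x /negPf->; rewrite mulr0.
Qed.

Lemma hecke_opU i (u : G) : hecke_op i << u >> = hecke_gen i u.
Proof.
rewrite /hecke_op msuppU (negPf (oner_neq0 _)) big_seq_fset1 mcoeffU eqxx.
exact: scale1r.
Qed.

Lemma hecke_opE i (x : {malg laurent[G]}) v :
  (hecke_op i x)@_(f v) = \sum_w x@_(f w) * (hecke_gen i (f w))@_(f v).
Proof.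
rewrite /hecke_op raddf_sum /=; under eq_bigr => w _ do rewrite mcoeffZ.
rewrite (sum_seq_bij fbij) ?fset_uniq // => w /mcoeff_outdom->.
by rewrite mul0r.
Qed.

Variable k : V -> V -> nat.
Hypothesis kE : forall u v, wt G (f u) (f v) = (k u v)%:R.
Let t u := tau G (f u).

Let genE i u v : (hecke_gen i (f u))@_(f v) =
  if i \in t u
  then - (u == v)%:R + (if i \in t v then 0 else qhalf * (k u v)%:R)
  else qvar * (u == v)%:R.
Proof. by rewrite hecke_genE kE (inj_eq (bij_inj fbij)). Qed.

Let hecke_op_desc i x v : i \in t v -> (hecke_op i x)@_(f v) = - x@_(f v).
Proof.
move=> iv; rewrite hecke_opE (bigD1 v) //= big1 ?addr0 => [|w /negPf wv].
  by rewrite genE iv eqxx addr0 mulrN mulr1.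
by rewrite genE iv wv oppr0 addr0 mulr0 if_same mulr0.
Qed.

Let hecke_op_fix i x v : i \notin t v ->
  (hecke_op i x)@_(f v) =
  qvar * x@_(f v) + qhalf * \sum_(w | i \in t w) x@_(f w) * (k w v)%:R.
Proof.
move=> iv; rewrite hecke_opE (bigID (fun w => i \in t w)) /= addrC.
congr (_ + _).
  rewrite (bigD1 v) //= genE (negPf iv) eqxx mulr1 mulrC big1 ?addr0 //.
  by move=> w /andP[iw /negPf wv]; rewrite genE (negPf iw) wv !mulr0.
rewrite mulr_sumr; apply: eq_bigr => w iw; rewrite genE iw (negPf iv).
case: eqP => [wv|_]; first by rewrite -wv iw in iv.
by rewrite oppr0 add0r mulrCA.
Qed.

(** [hecke_op j] acts by [-1] on the coefficient at a vertex with descent [j], so the eigenvalue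
    [qvar] forces that coefficient to vanish. *)
Let eig i j x v : j \in t v -> (hecke_op j (hecke_op i x))@_(f v) =
  qvar * (hecke_op i x)@_(f v) -> (hecke_op i x)@_(f v) = 0.
Proof.
move=> jv E; apply: laurent_opp_eq_qvar; apply: etrans E.
exact/esym/hecke_op_desc.
Qed.

Let hecke_op_scale i (c : laurent) (x : {malg laurent[G]}) :
  hecke_op i (c *: x) = c *: hecke_op i x.
Proof.
case: hW => lin _ _; have T0 : hecke_op i (0 : {malg laurent[G]}) = 0.
  by rewrite /hecke_op msupp0 big_seq_fset0.
by have := lin i c x 0; rewrite T0 !addr0.
Qed.

Let hecke_op_nodesc i u : i \notin t u ->
  hecke_op i << f u >> = qvar *: << f u >>.
Proof. by move=> iu; rewrite hecke_opU /hecke_gen -/(t u) (negPf iu). Qed.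

(** As [j] is not a descent of [u], commutation gives T_j(T_i u) = T_i(T_j u) = q T_i u. By [eig],
    the coefficient of T_i u at [v], which is q^{1/2} times the weight, is zero. *)
Lemma wgraph_compatibility i j u v : i != j -> cox i j = 2%N ->
  i \in t u -> j \notin t u -> i \notin t v -> j \in t v -> k u v = 0%N.
Proof.
move=> ij cij iu ju iv jv; have := hW => -[_ /(_ i j ij)]; rewrite cij /=.
move=> /(_ << f u >>) /= + _; rewrite (hecke_op_nodesc ju) hecke_op_scale.
move=> /(congr1 (mcoeff (f v))); rewrite mcoeffZ => /esym/(eig jv).
rewrite hecke_opU genE iu (negPf iv); case: eqP => [uv|_].
  by rewrite -uv iu in iv.
rewrite oppr0 add0r => /(laurent_mulI qhalf_neq0) H.
exact: laurent_natr_inj.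
Qed.

(** Expand over the intermediate vertex [w]. The cases [w = u] and [w = v] give the first term,
    which is symmetric in [i] and [j]; vertices other than [u] having both descents contribute
    nothing, and those with [i] but not [j] give the path sum. *)
Let hecke_op2 i j u v :  i \in t u -> j \in t u -> i \notin t v ->
  j \notin t v ->
  (hecke_op i (hecke_op j << f u >>))@_(f v) =
  (qvar * qhalf - qhalf) * (k u v)%:R +
  qvar * (\sum_(w | (i \in t w) && (j \notin t w)) k u w * k w v)%:R.
Proof.
move=> iu ju iv jv; have uv : u != v by apply: contraNneq iv => <-.
rewrite hecke_op_fix // hecke_opU genE ju (negPf jv) (negPf uv) oppr0 add0r.
rewrite (bigD1 u) //= genE ju eqxx addr0 mulN1r mulrDr mulrN mulrBl.
rewrite !mulrA -!addrA; congr (_ + (_ + _)); rewrite /qvar expr2 -mulrA.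
congr (_ * _); rewrite (bigID (fun w => j \in t w)) /= big1 ?add0r.
  rewrite natr_sum mulr_sumr (eq_bigl (fun w => [&& i \in t w & j \notin t w])).
    apply: eq_bigr => w /andP[iw jw].
    rewrite genE ju (negPf jw); case: eqP => [uw|_].
      by rewrite -uw ju in jw.
    by rewrite oppr0 add0r natrM mulrA.
  move=> w; case: eqP => [->|_]; last by rewrite andbT.
  by rewrite ju !andbF.
move=> w /andP[/andP[_ uw] jw].
by rewrite genE ju jw eq_sym (negPf uw) oppr0 addr0 mul0r.
Qed.

(** Compare [hecke_op2] for T_i T_j and T_j T_i: the symmetric terms cancel and the path sums
    remain. *)
Lemma wgraph_polygon i j u v : i != j -> cox i j = 2%N ->
  i \in t u -> j \in t u -> i \notin t v -> j \notin t v ->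
  (\sum_(w | (i \in t w) && (j \notin t w)) k u w * k w v =
   \sum_(w | (j \in t w) && (i \notin t w)) k u w * k w v)%N.
Proof.
move=> ij cij iu ju iv jv; have := hW => -[_ /(_ i j ij)]; rewrite cij /=.
move=> /(_ << f u >>) /= + _ => /(congr1 (mcoeff (f v))).
move/(etrans (esym (hecke_op2 iu ju iv jv)))/esym.
move/(etrans (esym (hecke_op2 ju iu jv iv)))/esym.
by move/addrI/qvar_natr_inj.
Qed.

(** Since T_i u = q u, the braid relation reads T_j(T_i T_j u) = q T_i T_j u, so by [eig] the
    coefficient of T_i T_j u at [v] vanishes. That coefficient is q times the path sum minus q if
    [u = v]. *)
Lemma wgraph_bonding i j u v : i != j -> cox i j = 3%N ->
  j \in t u -> i \notin t u -> j \in t v -> i \notin t v ->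
  (\sum_(w | (i \in t w) && (j \notin t w)) k u w * k w v)%N = (u == v).
Proof.
move=> ij cij ju iu jv iv; have := hW => -[_ /(_ i j ij)]; rewrite cij /=.
move=> /(_ << f u >>) /= + _; rewrite (hecke_op_nodesc iu) !hecke_op_scale.
move=> /(congr1 (mcoeff (f v))); rewrite mcoeffZ => /esym/(eig jv).
rewrite hecke_op_fix // hecke_opU genE ju jv addr0 mulrN.
rewrite (bigID (fun w => j \in t w)) /= big1 ?add0r => [|w /andP[iw jw]].
  under eq_bigr => w /andP[iw jw].
    rewrite genE ju (negPf jw); have -> : u == w = false.
      by apply: contraNF jw => /eqP <-.
    rewrite oppr0 add0r -mulrA -natrM; over.
  rewrite -mulr_sumr -natr_sum mulrA -expr2 -/qvar => /eqP.
  by rewrite addrC subr_eq0 => /eqP/qvar_natr_inj.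
rewrite genE ju jw addr0; case: eqP => [uw|_]; last by rewrite oppr0 mul0r.
by rewrite uw iw in iu.
Qed.

End HeckeRelations.

(** * Tableaux as subsets *)

Lemma rep_inj n : (1 < n)%N -> injective (@rep n).
Proof.
move=> n1 x y; have lt_n (z : 'Z_n) : (z < n)%N by rewrite -{2}(Zp_cast n1).
have [xn yn] := (lt_n x, lt_n y); rewrite /rep.
case: eqP => [->|_]; case: eqP => [->|_] // E; apply: val_inj => //.
- by move: yn; rewrite /= -E ltnn.
- by move: xn; rewrite /= E ltnn.
Qed.

Definition row_cell la (r : 'I_(size la)) (c : 'I_(nth 0%N la r)) : cell la :=
  Tagged (fun r : 'I_(size la) => 'I_(nth 0%N la r)) c.

Section Rows.
Variables (n : nat) (la : seq nat).
Implicit Types (s t : RSYT n la) (r : 'I_(size la)).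

Lemma rsyt_entry_inj s : injective (val s).
Proof.
have /andP[/forallP H _] := valP s => c d E.
have /card1P[e He] := H (val s d).
have := He c; have := He d; rewrite !inE E eqxx => /esym/eqP-> /esym/eqP->.
by [].
Qed.

Lemma rsyt_entry_surj s x : exists c, val s c = x.
Proof.
have /andP[/forallP /(_ x)/card1P[e He] _] := valP s.
by exists e; have := He e; rewrite !inE eqxx => /eqP.
Qed.

Lemma mem_trow s r x :
  reflect (exists c : 'I_(nth 0%N la r), val s (row_cell c) = x)
  (x \in trow s r).
Proof.
apply: (iffP imsetP) => [[[q c]]|[c <-]].
  by rewrite inE /= => /eqP/val_inj rq -> /=; subst q; exists c.
by exists (row_cell c); rewrite ?inE.
Qed.

Lemma card_trow s r : #|trow s r| = nth 0%N la r.
Proof.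
rewrite card_imset; last exact: rsyt_entry_inj.
rewrite -[RHS]card_ord -cardsT -(@card_imset _ _ (@row_cell la r)); last first.
  by move=> c d /eqP; rewrite eq_Tagged /= => /eqP.
congr #|pred_of_set _|; apply/setP => -[q c]; rewrite inE.
apply/eqP/imsetP => /= [/val_inj rq|[d _]]; first by subst q; exists c.
by move/(congr1 tag) => /= ->.
Qed.

Lemma trow_disjoint s r (q : 'I_(size la)) x :
  x \in trow s r -> x \in trow s q -> r = q.
Proof.
move=> /mem_trow[c <-] /mem_trow[d /rsyt_entry_inj].
by move/(congr1 tag).
Qed.

Lemma trow_cover s x : exists r, x \in trow s r.
Proof.
have [[r c] <-] := rsyt_entry_surj s x.
by exists r; apply/mem_trow; exists c.
Qed.

Let row_word s r : seq nat :=
  [seq rep (val s (@row_cell la r c)) | c <- enum 'I_(nth 0%N la r)].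

Let row_word_sorted s r : sorted ltn (row_word s r).
Proof.
rewrite sorted_map; have /andP[_ /forallP /(_ r) /forallP H] := valP s.
apply: (@sub_sorted _ (relpre val ltn)).
  by move=> c d /= cd; have /forallP/(_ d)/implyP/(_ cd) := H c.
by rewrite -sorted_map val_enum_ord iota_ltn_sorted.
Qed.

(** Rows increase strictly, so each row is the sorted listing of its set of entries. *)
Lemma trow_inj s t : (1 < n)%N ->
  (forall r, trow s r = trow t r) -> s = t.
Proof.
move=> n1 E; apply/val_inj/ffunP => -[r c].
have W : row_word s r = row_word t r.
  apply: (irr_sorted_eq ltn_trans ltnn) => // x.
  have row_sub u v : trow u r = trow v r -> x \in row_word u r ->
    x \in row_word v r.
    move=> uv /mapP[d _ ->].
    have : val u (row_cell d) \in trow v r by rewrite -uv; apply/mem_trow;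
      exists d.
    by move=> /mem_trow[e <-]; apply: map_f; rewrite mem_enum.
  by apply/idP/idP; apply: row_sub.
move/eq_in_map: W => /(_ c); rewrite mem_enum => /(_ isT).
by move/(rep_inj n1).
Qed.

End Rows.

Section TwoRows.
Variable a : nat.
Hypothesis a1 : (1 < a)%N.
Let n := (2 * a)%N.
Let n1 : (1 < n)%N. Proof. by rewrite /n; lia. Qed.
Notation tab := (RSYT n [:: a; a]).
Implicit Types (s t : tab).

Lemma trow1E s : trow s 1 = ~: trow s 0.
Proof.
apply/setP => x; rewrite inE; have [r xr] := trow_cover s x.
have D := @trow_disjoint _ _ s.
apply/idP/idP => [x1|].
  by apply/negP => x0; have := D (@Ordinal 2 0 isT) (@Ordinal 2 1 isT) x x0 x1.
by case: r xr => -[|[|//]] ? // ->.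
Qed.

Lemma card_trow0 s : #|trow s 0| = a.
Proof. exact: (card_trow s (@Ordinal 2 0 isT)). Qed.

Lemma trow0_inj s t : trow s 0 = trow t 0 -> s = t.
Proof.
move=> E; apply: trow_inj => // -[[|[|//]] ?] //=.
by rewrite !trow1E E.
Qed.

Lemma desbarE s i :
  (i \in desbar s) = (i \in trow s 0) && (i + 1 \notin trow s 0).
Proof.
rewrite inE; apply/existsP/andP => [[[[|[|//]] ?] /existsP[[[|[|//]] ?]]] //=|].
  by rewrite trow1E inE => /andP.
move=> [i0 i1]; exists (@Ordinal 2 0 isT); apply/existsP.
by exists (@Ordinal 2 1 isT); rewrite /= i0 trow1E inE.
Qed.

Lemma interchangedE x y s t :
  trow t 0 = [set tperm x y z | z in trow s 0] -> interchanged x y s t.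
Proof.
move=> E; apply/forallP => -[[|[|//]] ?] /=; first by rewrite E.
rewrite !trow1E E; apply/eqP/setP => z; rewrite inE -(tpermK x y z).
by rewrite !mem_imset ?inE //; apply: perm_inj.
Qed.

(** Sorting [A] and its complement by [rep] gives the two rows. Together with [trow0_inj] this
    identifies tableaux with [a]-subsets, so that moves can be made on top rows alone. *)
Lemma rsyt_of_trow0 (A : {set 'Z_n}) : #|A| = a -> exists s, trow s 0 = A.
Proof.
move=> cA; pose B (r : nat) := if r == 0%N then A else ~: A.
have cB r : #|B r| = a.
  rewrite /B; case: ifP => // _; have := cardsC A.
  by rewrite cA [RHS](etrans (card_ord _) (Zp_cast n1)) /n; lia.
pose le (x y : 'Z_n) := (rep x <= rep y)%N.
pose w r := sort le (enum (B r)).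
have szw r : size (w r) = a by rewrite size_sort -cardE cB.
have memw r x : (x \in w r) = (x \in B r) by rewrite mem_sort mem_enum.
have uw r : uniq (w r) by rewrite sort_uniq enum_uniq.
have ordw r : sorted ltn (map (@rep n) (w r)).
  rewrite ltn_sorted_uniq_leq map_inj_uniq ?uw; last exact: rep_inj.
  by rewrite sorted_map; apply: sort_sorted => x y; apply: leq_total.
have nth_lt q i j : (i < j)%N -> (j < a)%N ->
    (rep (nth 0%R (w q) i) < rep (nth 0%R (w q) j))%N.
  move=> ij ja; have ia := ltn_trans ij ja.
  have := @sorted_ltn_nth _ _ ltn_trans 0%N _ (ordw q) i j.
  by rewrite !inE size_map szw !(nth_map 0) ?szw //; apply.
have nthla (r : 'I_2) : nth 0%N [:: a; a] r = a by case: r => -[|[|//]].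
pose rw (c : cell [:: a; a]) : nat := (tag c : 'I_(size [:: a; a])).
pose cl (c : cell [:: a; a]) : nat :=
  (tagged c : 'I_(nth 0%N [:: a; a] (tag c))).
pose T : {ffun cell [:: a; a] -> 'Z_n} := [ffun c => nth 0 (w (rw c)) (cl c)].
have ltc (c : cell [:: a; a]) : (cl c < a)%N.
  by apply: leq_trans (ltn_ord _) _; rewrite nthla.
have TB c : T c \in B (rw c).
  by rewrite ffunE -memw mem_nth // szw ltc.
have Tsurj x r : x \in B r -> (r < 2)%N -> exists2 c, T c = x & rw c = r.
  rewrite -memw => /[dup] xw; rewrite -index_mem szw => xi r2.
  have xi' : (index x (w r) < nth 0 [:: a; a] (Ordinal r2))%N by rewrite nthla.
  exists (@row_cell [:: a; a] (Ordinal r2) (Ordinal xi')) => //.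
  by rewrite ffunE /= nth_index.
have Tinj : injective T.
  move=> c d E; have cd : tag c = tag d.
    apply: val_inj; have := TB d; rewrite -E; have := TB c; rewrite /B.
    case: c {E} => -[[|[|//]] ?] c; case: d => -[[|[|//]] ?] d //=.
      by rewrite !inE => ->.
    by rewrite !inE => /negPf->.
  case: c d cd E => r c [q d] /= rq; subst q; rewrite !ffunE /= => /eqP.
  by rewrite nth_uniq ?szw //; move=> /eqP/val_inj /= ->.
have Trsyt : is_rsyt T.
  apply/andP; split.
    apply/forallP => x; apply/card1P.
    have [q [xr r2]] : exists q, x \in B q /\ (q < 2)%N.
      by case: (boolP (x \in A)) => xA; [exists 0%N|exists 1%N];
        rewrite /B /= ?inE.
    have [c Tc _] := Tsurj x q xr r2; exists c => d.
    by rewrite !inE -Tc (inj_eq Tinj).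
  apply/forallP => r; apply/forallP => c; apply/forallP => d;
    apply/implyP => cd.
  by rewrite !ffunE; apply: nth_lt cd (ltc (row_cell d)).
exists (exist _ T Trsyt); apply/setP => x; apply/imsetP/idP => /= [[c + ->]|xA].
  by rewrite inE => /eqP c0; have := TB c; have -> : rw c = 0%N by exact: c0.
have [c Tc c0] := Tsurj x 0%N xA isT.
by exists c; rewrite // inE; apply/eqP.
Qed.

End TwoRows.

(** * Positions on the cycle as offsets from a base point *)

Section CyclicPositions.
Variable n : nat.
Hypothesis n1 : (1 < n)%N.
Implicit Types (b x : 'Z_n) (A : {set 'Z_n}) (k l m : nat).

Lemma ltn_Zp x : (x < n)%N.
Proof. by apply: leq_trans (ltn_ord x) _; rewrite Zp_cast. Qed.

Lemma val_shiftB b k l : (k < n)%N -> (l < n)%N ->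
  nat_of_ord (b + k%:R - (b + l%:R)) =
  (if (l <= k)%N then k - l else n + k - l)%N.
Proof.
move=> kn ln; have -> : b + k%:R - (b + l%:R) = k%:R - l%:R.
  by rewrite opprD addrACA subrr add0r.
case: leqP => lk; first by rewrite -natrB // val_Zp_nat // modn_small //; lia.
rewrite -[k%:R]add0r -(pchar_Zp n1) -natrD -natrB; last by lia.
by rewrite val_Zp_nat // modn_small //; lia.
Qed.

Lemma shift_eq b k l : (k < n)%N -> (l < n)%N ->
  (b + k%:R == b + l%:R) = (k == l).
Proof.
move=> kn ln; rewrite (inj_eq (addrI b)); apply/eqP/eqP => [|-> //].
by move/(congr1 (@nat_of_ord _)); rewrite !val_Zp_nat // !modn_small.
Qed.

Lemma shiftP b x : exists2 k, (k < n)%N & x = b + k%:R.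
Proof.
exists (x - b : 'Z_n); first exact: ltn_Zp.
by rewrite natr_Zp addrC subrK.
Qed.

Lemma rep_natr k : (0 < k < n)%N -> @rep n k%:R = k.
Proof.
move=> /andP[k0 kn]; rewrite /rep val_Zp_nat // modn_small //.
case: eqP => // /(congr1 (@nat_of_ord _));
  rewrite val_Zp_nat // modn_small //= => E.
by rewrite E in k0.
Qed.

Lemma card_shift b A : #|A| = (\sum_(0 <= k < n) ((b + k%:R)%R \in A))%N.
Proof.
rewrite -sum1_card big_mkcond big_mkord /=.
rewrite (reindex (fun k : 'I_n => b + (k : nat)%:R)) /=.
  by apply: eq_bigr => k _; case: ifP.
exists (fun x => Ordinal (ltn_Zp (x - b))) => [k _|x _].
  apply: val_inj; rewrite -[LHS]/(nat_of_ord (b + (k : nat)%:R - b)).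
  by rewrite addrC addKr val_Zp_nat // modn_small.
rewrite -[X in b + X]/((nat_of_ord (x - b))%:R).
by rewrite natr_Zp addrC subrK.
Qed.

(** The bound [l <= m.+1] admits the empty interval, while [m.+1 - l < n] excludes the full circle,
    whose endpoints would encode the empty interval. *)
Lemma cyc_intervalE b k l m : (k < n)%N -> (l < n)%N -> (m < n)%N ->
  (l <= m.+1)%N -> (m.+1 - l < n)%N ->
  (b + k%:R \in cyc_interval (b + l%:R) (b + m%:R)) = (l <= k <= m)%N.
Proof.
move=> kn ln mn lm ml; rewrite /cyc_interval.
have [lm'|ml'] := leqP l m.
  rewrite ifF ?inE ?val_shiftB // ?lm'; first by case: (leqP l k) => lk; lia.
  rewrite -addrA natr1.
  have [mn'|mn'] := ltnP m.+1 n; first by rewrite shift_eq //; lia.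
  have -> : m.+1 = n by lia.
  by rewrite pchar_Zp // -[0]/(0%:R) shift_eq //; lia.
have -> : l = m.+1 by lia.
rewrite -addrA natr1 eqxx inE; lia.
Qed.

Lemma card_cyc_interval b A l m : (l < n)%N -> (m < n)%N ->
  (l <= m.+1)%N -> (m.+1 - l < n)%N ->
  #|A :&: cyc_interval (b + l%:R) (b + m%:R)| =
  (\sum_(l <= k < m.+1) ((b + k%:R)%R \in A))%N.
Proof.
move=> ln mn lm ml; rewrite (card_shift b).
have inI k : (k < n)%N ->
    ((b + k%:R)%R \in A :&: cyc_interval (b + l%:R) (b + m%:R)) =
    ((b + k%:R)%R \in A) && (l <= k <= m)%N.
  by move=> kn; rewrite in_setI cyc_intervalE.
rewrite (@big_cat_nat _ _ _ l) //=; last exact: ltnW.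
rewrite (@big_cat_nat _ _ _ m.+1 l n) //=.
rewrite [X in (X + _)%N]big_nat [X in (X + _)%N]big1 ?add0n => [|k /andP[_ kl]].
  rewrite [X in (_ + X)%N]big_nat [X in (_ + X)%N]big1 ?addn0 =>
    [|k /andP[mk kn]].
    rewrite [LHS]big_nat [RHS]big_nat; apply: eq_bigr => k /andP[lk km].
    by rewrite inI ?lk -1?ltnS ?km ?andbT //; apply: leq_trans km _.
  by rewrite inI // [(k <= m)%N]leqNgt mk !andbF.
by rewrite inI 1?(ltn_trans kl) // leqNgt kl andbF.
Qed.

End CyclicPositions.

(** * Edges of the graph Gamma *)

(** For [A] a top row, [2 * prefix_count A b l - l] is the height, after [l] steps, of the lattice
    path read from [b] with top entries as up-steps and bottom entries as down-steps. *)
Definition prefix_count n (A : {set 'Z_n}) (b : 'Z_n) (l : nat) : nat :=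
  (\sum_(0 <= k < l) ((b + k%:R)%R \in A))%N.

Lemma prefix_countS n (A : {set 'Z_n}) b l :
  prefix_count A b l.+1 = (prefix_count A b l + ((b + l%:R)%R \in A))%N.
Proof. by rewrite /prefix_count big_nat_recr. Qed.

Lemma prefix_count_setC n (A B : {set 'Z_n}) b l m : (l <= m)%N ->
  (forall k, (l <= k < m)%N -> (b + k%:R \in B) = (b + k%:R \notin A)) ->
  (\sum_(l <= k < m) ((b + k%:R)%R \in B) + prefix_count A b m =
   m - l + prefix_count A b l)%N.
Proof.
move=> lm AB; rewrite /prefix_count (@big_cat_nat _ _ _ l 0 m) //=.
rewrite addnCA addnC; congr (_ + _)%N.
rewrite -big_split /= big_nat -[RHS]muln1 -sum_nat_const_nat [RHS]big_nat.
by apply: eq_bigr => k /AB->; case: (_ \in A).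
Qed.

Section GammaEdges.
Variable a : nat.
Hypothesis a1 : (1 < a)%N.
Let n := (2 * a)%N.
Let n1 : (1 < n)%N. Proof. by rewrite /n; lia. Qed.
Notation tab := (RSYT n [:: a; a]).
Implicit Types (s t : tab) (b i x y : 'Z_n).

Lemma exists_swap t x y :
  exists s : tab, trow s 0 = [set tperm x y z | z in trow t 0].
Proof.
by apply: rsyt_of_trow0; rewrite // card_imset ?card_trow0 //; apply: perm_inj.
Qed.

Lemma mem_swap s t x y z : trow s 0 = [set tperm x y z | z in trow t 0] ->
  (z \in trow s 0) = (tperm x y z \in trow t 0).
Proof.
by move=> ->; rewrite -{1}(tpermK x y z) mem_imset //; apply: perm_inj.
Qed.

Lemma swap_sym s t x y : trow s 0 = [set tperm x y z | z in trow t 0] ->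
  trow t 0 = [set tperm x y z | z in trow s 0].
Proof.
move=> E; apply/setP => z.
rewrite -[X in _ = (X \in _)](tpermK x y z) mem_imset; last by apply: perm_inj.
by rewrite (mem_swap _ E) tpermK.
Qed.

Lemma succ_neq x : x + 1 != x.
Proof. by rewrite -subr_eq0 addrC addKr oner_neq0. Qed.

Lemma first_kind_swap s t i : i \notin trow t 0 -> i + 1 \in trow t 0 ->
  trow s 0 = [set tperm i (i + 1) z | z in trow t 0] ->
  i \in desbar s /\ first_kind s t.
Proof.
move=> i0 i1 E; rewrite desbarE // !(mem_swap _ E) tpermL tpermR i0 i1;
  split=> //.
apply/existsP; exists i; rewrite trow1E // inE !(mem_swap _ E) tpermL tpermR i0
  i1.
exact/interchangedE/swap_sym.
Qed.

(* The entries in offsets [p, q] from [b] form the ballot word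
   "top, balanced word, bottom", whose ends are interchanged. *)
Lemma second_kind_swap s t b p q : (p < q < n)%N -> odd (q - p) ->
  let H := prefix_count (trow t 0) b in
  b + p%:R \in trow t 0 -> b + q%:R \notin trow t 0 ->
  (2 * H q = 2 * H p + (q - p) + 1)%N ->
  (forall l, p < l <= q -> 2 * H q <= 2 * H l + (q - l))%N ->
  (b + p%:R - 1 \in trow t 0) || (b + q%:R + 1 \notin trow t 0) ->
  trow s 0 = [set tperm (b + p%:R) (b + q%:R) z | z in trow t 0] ->
  second_kind s t.
Proof.
move=> /andP[pq qn] oddd H xt yt Hpq Hl ends E.
have pn := ltn_trans pq qn.
have q0 : (0 < q)%N by apply: leq_trans pq.
set x := b + p%:R in xt ends E *; set y := b + q%:R in yt ends E *.
have HS l : H l.+1 = (H l + ((b + l%:R)%R \in trow t 0))%N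
  by apply: prefix_countS.
have repd : rep (y - x) = (q - p)%N.
  rewrite /x /y opprD addrACA subrr add0r -natrB 1?ltnW //.
  by rewrite rep_natr // subn_gt0 pq (leq_ltn_trans (leq_subr _ _) qn).
have xs : x \notin trow s 0 by rewrite (mem_swap _ E) tpermL.
have ys : y \in trow s 0 by rewrite (mem_swap _ E) tpermR.
have off z : z != x -> z != y -> (z \in trow s 0) = (z \in trow t 0).
  by move=> zx zy; rewrite (mem_swap _ E) tpermD // eq_sym.
have ins k : (p < k < q)%N -> (b + k%:R \in trow s 0) = (b + k%:R \in trow t 0).
  move=> /andP[pk kq]; have kn := ltn_trans kq qn.
  by rewrite off // shift_eq // ?(gtn_eqF pk) ?(ltn_eqF kq).
(* [Hl] at [p + 2] gives [H (p + 2) >= H p + 2]: both entries at offsets [p] and [p + 1] are top. *)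
have x1 : (p.+1 < q)%N -> b + p.+1%:R \in trow t 0.
  move=> qp; have := Hl p.+2; have := HS p; have := HS p.+1.
  rewrite xt -/x qp ltnW //; move: Hpq; case: (_ \in _) => //.
  by move: qp; clear; lia.
(* [Hl] at [q - 1] gives [H (q - 1) = H q]. *)
have y1 : (p.+1 < q)%N -> b + q.-1%:R \notin trow t 0.
  move=> qp; have := Hl q.-1; have := HS q.-1; rewrite prednK //.
  by move: Hpq qp; case: (_ \in _) => //; clear; lia.
have xS : x + 1 = b + p.+1%:R by rewrite -natr1 addrA.
have ysub k : (k <= q)%N -> y - k%:R = b + (q - k)%:R.
  by move=> kq; rewrite /y natrB // addrA.
have yP : y - 1 = b + q.-1%:R by rewrite -subn1 -ysub.
have xP : x + 1 \in trow s 0.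
  rewrite xS; case: (ltngtP p.+1 q) pq => // [qp _|-> //].
  by rewrite ins ?x1 // leqnn.
have yS : y - 1 \notin trow s 0.
  rewrite yP; case: (ltngtP p.+1 q) pq => // [qp _|<- //].
  by rewrite ins ?y1 // ltn_predL q0 andbT -ltnS prednK.
have odd1 : p.+1 != q -> (p.+3 <= q)%N by move: pq oddd; clear; lia.
have HqP : (p.+3 <= q)%N -> H q.-1 = H q.
  move=> d3; rewrite -{2}(prednK q0) HS (negPf (y1 _)) ?addn0 //.
  exact: ltnW.
have cardN l : (p.+3 <= q -> p < l <= q.-1 ->
    #|~: trow s 0 :&: cyc_interval (b + l%:R)%R (y - 2)%R| + H q.-1 =
    q.-1 - l + H l)%N.
  move=> d3 /andP[pl lq]; rewrite ysub; last by move: d3; clear; lia.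
  have q2 : (q - 2).+1 = q.-1 by move: d3; clear; lia.
  rewrite card_cyc_interval ?q2 //; try by move: d3 pl lq qn; clear; lia.
  apply: prefix_count_setC lq _ => k /andP[lk kq]; rewrite inE ins //.
  by move: kq lk pl; clear; lia.
apply/existsP; exists x; apply/existsP; exists y.
rewrite repd trow1E // !inE xs ys interchangedE ?oddd ?(swap_sym E) //=.
rewrite xP yS oddd /=; apply/and4P; split.
- by apply: contraTneq ends => E1; rewrite E1 addrK (negPf yt) -E1 xt.
- move: ends; have [E1|yx1] := eqVneq (x - 1) y.
    by rewrite E1 (negPf yt) ys.
  have xx1 : x - 1 != x by rewrite -{2}[x](subrK 1) eq_sym succ_neq.
  have [E1|xy1] := eqVneq (y + 1) x; first by rewrite E1 xt xs orbT.
  by rewrite !off // succ_neq.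
(* [Hl] at [l = q - (2k + 1)] gives [H q - H l <= k], so at least [k] of the [2k] entries of this
   interval are in the bottom row. *)
- apply/forallP => -[k /= kh]; apply/implyP => k0.
  have [kq d3] : (2 * k <= q - p - 3 /\ p.+3 <= q)%N.
    by move: kh k0; clear; lia.
  have -> : y - 1 - (2 * k)%:R = b + (q - (2 * k).+1)%:R.
    by rewrite -addrA -opprD nat1r ysub //; move: kq d3; clear; lia.
  have pl : (p < q - (2 * k).+1 <= q.-1)%N by move: kq d3; clear; lia.
  have pl' : (p < q - (2 * k).+1 <= q)%N by move: pl; clear; lia.
  have := cardN _ d3 pl; have := Hl _ pl'; rewrite (HqP d3).
  by move: #|_| (H _) (H _) kq d3; clear; lia.
(* The word at offsets [p + 2] to [q - 2] starts at [H p + 2] and ends at [H q]; [Hpq] makes exactly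
   half of its entries bottom. *)
apply/implyP => yx1; have d3 : (p.+3 <= q)%N.
  by apply: odd1; apply: contraNneq yx1 => p1q; rewrite xS p1q.
have -> : x + 2 = b + p.+2%:R by rewrite /x -addrA -natrD addn2.
have pl : (p < p.+2 <= q.-1)%N by move: d3; clear; lia.
have := cardN _ d3 pl; rewrite (HqP d3) (HS p.+1) (HS p) xt x1;
  last exact: ltnW.
by move: #|_| d3 Hpq oddd; clear; lia.
Qed.

Lemma prefix_count_full t b : prefix_count (trow t 0) b n = a.
Proof. by rewrite /prefix_count -card_shift // card_trow0. Qed.

(* [q] is the bracket partner of the top entry at offset [0]: the first place
   where the height of the word read from [b] returns to 0. *)
Lemma partner_right t b : b \in trow t 0 -> b - 1 \in trow t 0 ->
  exists q, let H := prefix_count (trow t 0) b in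
  [/\ (0 < q < n.-1)%N, odd q, b + q%:R \notin trow t 0, (2 * H q = q + 1)%N &
    (forall l, 0 < l <= q -> 2 * H q <= 2 * H l + (q - l))%N].
Proof.
move=> bt bt1; set H := prefix_count _ b.
have HS l : H l.+1 = (H l + ((b + l%:R)%R \in trow t 0))%N
  by apply: prefix_countS.
have H0 : H 0%N = 0%N by rewrite /H /prefix_count big_geq.
have Hn : H n = a by exact: prefix_count_full.
have H1 : H 1%N = 1%N by rewrite HS H0 addr0 bt.
have last_top : b + (n.-1)%:R \in trow t 0.
  by rewrite -subn1 natrB 1?ltnW // pchar_Zp // sub0r.
have nE : n.-1.+1 = n by rewrite prednK // ltnW.
(* The entry at offset [n - 1] is top, so [H (n - 1) = a - 1] and the path has height -1 after
   [n - 1] steps. *)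
have ex : exists q, (2 * H q.+1 <= q.+1)%N.
  exists n.-2; rewrite prednK; last by move: a1; rewrite /n; clear; lia.
  have := HS n.-1; rewrite nE Hn last_top; rewrite /n; move: a1; clear; lia.
have [q Hq qmin] := ex_minnP ex.
have qn : (q <= n.-2)%N.
  apply: qmin; rewrite prednK; last by move: a1; rewrite /n; clear; lia.
  have := HS n.-1; rewrite nE Hn last_top; rewrite /n; move: a1; clear; lia.
have q0 : (0 < q)%N by case: q Hq {qmin qn} => //; rewrite H1.
have Hmin l : (0 < l <= q)%N -> (l < 2 * H l)%N.
  case: l => // l lq; rewrite ltnNge; apply/negP => /qmin.
  by rewrite leqNgt; case/andP: lq => _ ->.
exists q; have Hqq := Hmin q; rewrite q0 leqnn in Hqq; have {}Hqq := Hqq isT.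
have [yt Hq1] : b + q%:R \notin trow t 0 /\ (2 * H q = q + 1)%N.
  by move: Hq Hqq; rewrite HS; case: (_ \in _) => /=; clear; lia.
split=> //.
- by move: q0 qn a1; rewrite /n; clear; lia.
- by move: Hq1; clear; lia.
- by move=> l /[dup] lq /Hmin; move: Hq1 lq; clear; lia.
Qed.

(* Dually, [p] is the bracket partner of the bottom entry at offset [n - 2]. *)
Lemma partner_left t b : b - 2 \notin trow t 0 -> b - 1 \notin trow t 0 ->
  exists p, let H := prefix_count (trow t 0) b in
  [/\ (p < n - 2)%N, odd (n - 2 - p), b + p%:R \in trow t 0,
    (2 * H (n - 2) = 2 * H p + (n - 2 - p) + 1)%N &
    (forall l, p < l <= n - 2 -> 2 * H (n - 2) <= 2 * H l + (n - 2 - l))%N].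
Proof.
move=> bt2 bt1; set H := prefix_count _ b.
have HS l : H l.+1 = (H l + ((b + l%:R)%R \in trow t 0))%N
  by apply: prefix_countS.
have H0 : H 0%N = 0%N by rewrite /H /prefix_count big_geq.
have off k : (k <= n)%N -> b + (n - k)%:R = b - k%:R.
  by move=> kn; rewrite natrB // pchar_Zp // sub0r.
have Hn2 : H (n - 2)%N = a.
  have := prefix_count_full t b; rewrite -/H.
  have {1}-> : n = (n - 2).+2 by move: a1; rewrite /n; clear; lia.
  rewrite !HS; have -> : (n - 2).+1 = (n - 1)%N by move: a1; rewrite /n;
    clear; lia.
  by rewrite !off ?(ltnW n1) // (negPf bt1) (negPf bt2) !addn0.
(* [P l] says that the path has height at most 1 before offset [l]. Two bottom entries end the word,
   so the height before offset [n - 2] is 2; [p] is where the path last leaves height 1. *)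
pose P l := (l < n - 2)%N && (2 * H l <= l.+1)%N.
have P0 : P 0%N by rewrite /P H0; move: a1; rewrite /n; clear; lia.
have Pub l : P l -> (l <= n)%N by move=> /andP[]; clear; lia.
have [p /andP[pn Hp] pmax] := ex_maxnP (ex_intro _ 0%N P0) Pub.
have Hmax l : (p < l <= n - 2)%N -> (l.+2 <= 2 * H l)%N.
  move=> /andP[pl]; rewrite leq_eqVlt => /orP[/eqP->|ln].
    by rewrite Hn2; move: a1; rewrite /n; clear; lia.
  by rewrite ltnNge; apply: contraTN pl => Hl; rewrite -leqNgt pmax // /P ln.
have [xt Hpp] : b + p%:R \in trow t 0 /\ (2 * H p = p.+1)%N.
  have := Hmax p.+1; rewrite leqnn pn HS => /(_ isT); move: Hp.
  by case: (_ \in _) => /=; clear; lia.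
exists p; split=> //.
- by move: Hpp pn; rewrite /n; clear; lia.
- by rewrite Hn2 Hpp; move: pn; rewrite /n; clear; lia.
- by move=> l /[dup] lq /Hmax; rewrite Hn2; move: lq; rewrite /n; clear; lia.
Qed.

(** The letters of [t] at [i], [i + 1] are [-+], [--] or [++]. Exchange them in the first case.
    Otherwise exchange [i] with its bracket partner to the left for [--], and [i + 1] with its
    partner to the right for [++]. *)
Lemma gamma_edge_exists t i : i \notin desbar t ->
  exists s, i \in desbar s /\ (first_kind s t || second_kind s t).
Proof.
rewrite desbarE // negb_and negbK.
have [it /= it1|it _] := boolP (i \in trow t 0); last first.
  have [it1|it1] := boolP (i + 1 \in trow t 0).
    have [s E] := exists_swap t i (i + 1); exists s.
    by have [-> ->] := first_kind_swap it it1 E.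
  (* This base puts [i] at offset [n - 2], as [partner_left] requires. *)
  pose b := i + 2.
  have b2 : b - 2 = i by rewrite /b addrK.
  have b1 : b - 1 = i + 1 by rewrite /b -addrA -[2]/(1 + 1) addrK.
  have := @partner_left t b; rewrite b2 b1 => /(_ it it1)[p [pn oddp xt Hp Hl]].
  have yE : b + (n - 2)%:R = i.
    by rewrite natrB ?pchar_Zp // sub0r b2.
  have [s E] := exists_swap t (b + p%:R) (b + (n - 2)%:R); exists s.
  have xi1 : b + p%:R != i + 1 by apply: contraNneq it1 => <-.
  rewrite (@second_kind_swap s t b p (n - 2)) ?yE ?it1 ?orbT //; last first.
  - by rewrite -yE.
  - by rewrite pn ltn_subrL; move: n1; clear; lia.
  rewrite desbarE // !(mem_swap _ E) yE tpermR xt tpermD // ?it1 // eq_sym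
    ?succ_neq //.
have [|q [/andP[q0 qn] oddq yt Hq Hl]] := @partner_right t (i + 1) it1.
  by rewrite addrK.
have [s E] := exists_swap t (i + 1 + 0%:R) (i + 1 + q%:R); exists s.
rewrite (@second_kind_swap s t (i + 1) 0 q) ?orbT //; last first.
- by rewrite addr0 addrK it.
- by rewrite subn0 Hq /prefix_count big_geq.
- by rewrite addr0.
- by rewrite subn0.
- by rewrite q0; move: qn n1; clear; lia.
have iy : i + 1 + q%:R != i by apply: contraNneq yt => ->.
rewrite desbarE // !(mem_swap _ E) addr0 tpermL yt tpermD ?it //.
by rewrite succ_neq.
Qed.

End GammaEdges.

(** * Induction on Knuth moves *)

Lemma cox_affA_succ n (x : 'Z_n) :
  cox_affA x (x + 1) = 3%N /\ cox_affA (x + 1) x = 3%N.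
Proof.
rewrite /cox_affA !eqxx orbT /= eq_sym -subr_eq0 addrC addKr.
by rewrite (negPf (oner_neq0 _)).
Qed.

Lemma cox_affA_far n (x : 'Z_n) l : (1 < l < n.-1)%N ->
  x != x + l%:R /\ cox_affA x (x + l%:R) = 2%N.
Proof.
move=> ln; have n1 : (1 < n)%N by move: ln; clear; lia.
have E k m : (k < n)%N -> (m < n)%N -> k != m -> (x + k%:R == x + m%:R) = false.
  by move=> kn mn km; rewrite shift_eq //; apply: negbTE.
have x0 : x = x + 0%:R by rewrite addr0.
have xl : (x == x + l%:R) = false by rewrite {1}x0 E //; move: ln; clear; lia.
rewrite /cox_affA xl; split=> //.
have -> : (x + l%:R == x + 1) = false.
  by rewrite -[1]/(1%:R) E //; move: ln; clear; lia.
by rewrite -addrA natr1 {1}x0 E //; move: ln; clear; lia.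
Qed.

Section DescentWeights.
Variable a : nat.
Hypothesis a1 : (1 < a)%N.
Let n := (2 * a)%N.
Let n1 : (1 < n)%N. Proof. by rewrite /n; lia. Qed.
Notation tab := (RSYT n [:: a; a]).
Implicit Types (s t u v w : tab) (i j : 'Z_n).

Lemma desbar_succ s i : i \in desbar s -> i + 1 \notin desbar s.
Proof. by rewrite !desbarE // => /andP[_ /negPf->]. Qed.

Variable k : tab -> tab -> nat.
Notation cox := (@cox_affA n).
Hypothesis compat : forall i j, i != j -> cox i j = 2%N -> forall u v,
  i \in desbar u -> j \notin desbar u -> i \notin desbar v -> j \in desbar v ->
  k u v = 0%N.
Hypothesis polygon : forall i j, i != j -> cox i j = 2%N -> forall u v,
  i \in desbar u -> j \in desbar u -> i \notin desbar v -> j \notin desbar v ->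
  (\sum_(w | (i \in desbar w) && (j \notin desbar w)) k u w * k w v =
   \sum_(w | (j \in desbar w) && (i \notin desbar w)) k u w * k w v)%N.
Hypothesis bonding : forall i j, i != j -> cox i j = 3%N -> forall u v,
  j \in desbar u -> i \notin desbar u -> j \in desbar v -> i \notin desbar v ->
  (\sum_(w | (i \in desbar w) && (j \notin desbar w)) k u w * k w v)%N =
  (u == v).
Hypothesis gamma_edge : forall s t, first_kind s t || second_kind s t ->
  k s t = 1%N.

(** This is [N_i(v)] of the outline. *)
Definition desc_weight i v := (\sum_(u | i \in desbar u) k u v)%N.

Let adjacent i j := (j == i + 1) || (i == j + 1).

Let adjacent_cox i j : adjacent i j -> i != j /\ cox i j = 3%N.
Proof.
have H x : x + 1 != x :> 'Z_n by rewrite -subr_eq0 addrC addKr oner_neq0.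
case/orP => /eqP->; last by rewrite H (cox_affA_succ j).2.
by rewrite eq_sym H (cox_affA_succ i).1.
Qed.

Let adjacent_sym i j : adjacent i j = adjacent j i.
Proof. exact: orbC. Qed.

Let adjacent_desbar i j s : adjacent i j -> i \in desbar s -> j \notin desbar s.
Proof.
case/orP => /eqP-> => [/desbar_succ //|]; apply: contraTN.
exact: desbar_succ.
Qed.

Lemma desc_weight_edge i v : i \notin desbar v ->
  exists2 s, i \in desbar s &
    (first_kind s v || second_kind s v) /\ k s v = 1%N.
Proof.
move=> iv; have [s [i_s sv]] := gamma_edge_exists a1 iv.
by exists s; rewrite ?gamma_edge.
Qed.

Lemma desc_weight_gt0 i v : i \notin desbar v -> (0 < desc_weight i v)%N.
Proof.
by move=> /desc_weight_edge[s i_s [_ sv]];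
  rewrite /desc_weight (bigD1 s) //= sv.
Qed.

Lemma desc_weight_uniq i u v w : (desc_weight i v <= 1)%N ->
  i \in desbar u -> k u v = 1%N -> i \in desbar w -> w != u -> k w v = 0%N.
Proof.
move=> + iu uv iw wu; rewrite /desc_weight (bigD1 u) //= uv (bigD1 w) /= ?iw //.
by clear; lia.
Qed.

(** Sum the bonding relation over all [u] with descent [j]: the products [N_j(w) k(w, v)], over [w]
    with descent [i], add up to 1. Each [N_j(w)] is positive because [j] is not a descent of [w]. *)
Lemma desc_weight_bond i j v : adjacent i j -> j \in desbar v ->
  (desc_weight i v <= 1)%N.
Proof.
move=> ij jv; have [neq cij] := adjacent_cox ij.
have iv : i \notin desbar v by apply: adjacent_desbar jv; rewrite adjacent_sym.
have [ji_in ij_in] : (forall s,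
  (i \in desbar s) && (j \notin desbar s) = (i \in desbar s))
    /\ (forall s, (j \in desbar s) && (i \notin desbar s) = (j \in desbar s)).
  split=> s; apply: andb_idr; apply: adjacent_desbar => //.
  by rewrite adjacent_sym.
have <- : (\sum_(u | (j \in desbar u) && (i \notin desbar u)) (u == v) = 1)%N.
  by rewrite (bigD1 v) ?jv //= eqxx big1 // => u /andP[_ /negPf->].
under eq_bigr => u /andP[ju iu] do rewrite -(bonding neq cij ju iu jv iv).
rewrite exchange_big /= /desc_weight.
rewrite [leqRHS](eq_bigl (fun w => i \in desbar w)) //.
apply: leq_sum => w iw; rewrite -big_distrl /= leq_pmull //.
rewrite (eq_bigl (fun u => j \in desbar u)) //; apply: desc_weight_gt0.
exact: adjacent_desbar ij iw.
Qed.

(* [j] and [j'] are the descents lost and gained by the Knuth move from [v] to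
   [v']. *)
Lemma desc_weight_knuth i j j' v v' :
  i != j -> cox i j = 2%N -> i != j' -> cox i j' = 2%N -> adjacent j j' ->
  j \in desbar v -> j' \in desbar v' -> i \notin desbar v ->
    i \notin desbar v' ->
  k v v' = 1%N -> (desc_weight i v' <= 1)%N -> (desc_weight i v <= 1)%N.
Proof.
move=> ij cij ij' cij' jj' jv j'v' iv iv' vv' Nv'.
have [w0 iw0 [_ w0v']] := desc_weight_edge iv'.
have j'w0 : j' \in desbar w0.
  apply/negPn/negP => H; have := compat ij' cij' iw0 H iv' j'v'.
  by rewrite w0v'.
have nj s : j' \in desbar s -> j \notin desbar s.
  by apply: adjacent_desbar; rewrite adjacent_sym.
(* [w0] has descent [j'], adjacent to [j], so [N_j(w0) <= 1]; it remains to bound [N_i(v)] by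
   [N_j(w0)] term by term. *)
apply: leq_trans (desc_weight_bond jj' j'w0).
rewrite /desc_weight (bigID (fun u => j \in desbar u)) /=.
rewrite [X in (_ + X)%N]big1 ?addn0 => [|u /andP[iu ju]]; last first.
  exact: compat iu ju iv jv.
rewrite [leqRHS](bigID (fun u => i \in desbar u)) /=.
apply: leq_trans (leq_addr _ _).
rewrite [leqRHS](eq_bigl (fun u => (i \in desbar u) && (j \in desbar u)));
  last first.
  by move=> u; rewrite andbC.
apply: leq_sum => u /andP[iu ju].
(* As [N_i(v') <= 1], only [w0] contributes on this side of the polygon relation; on the other side
   the term [w = v] is already [k u v]. *)
have <- : (\sum_(w | (i \in desbar w) && (j \notin desbar w)) k u w * k w v' =
  k u w0)%N.
  rewrite (bigD1 w0) ?iw0 ?nj //= w0v' muln1 big1 ?addn0 // =>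
    w /andP[/andP[iw _] ww0].
  by rewrite (desc_weight_uniq Nv' iw0 w0v' iw ww0) muln0.
rewrite (polygon ij cij iu ju iv' (nj _ j'v')) (bigD1 v) ?jv ?iv //=.
by rewrite vv' muln1 leq_addr.
Qed.


(** The termination measure, unrelated to the path height: total offset from [i] of the minus
    signs. *)
Let height i v : nat := (\sum_(x | x \notin trow v 0) nat_of_ord (x - i)%R)%N.

Lemma height_swap i v v' l : (l.+1 < n)%N ->
  i + l%:R \in trow v 0 -> i + l.+1%:R \notin trow v 0 ->
  trow v' 0 = [set tperm (i + l%:R) (i + l.+1%:R) x | x in trow v 0] ->
  (height i v' < height i v)%N.
Proof.
move=> ln lv lv1 E; set x := i + l%:R in lv E; set y := i + l.+1%:R in lv1 E.
have offE m : (m < n)%N -> nat_of_ord (i + m%:R - i) = m.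
  by move=> mn; rewrite addrC addKr val_Zp_nat // modn_small.
have -> : height i v' =
    (\sum_(z | z \notin trow v 0) nat_of_ord (tperm x y z - i)%R)%N.
  rewrite /height (reindex_inj (@perm_inj _ (tperm x y))); apply: eq_bigl => z.
  by rewrite (mem_swap _ E) tpermK.
rewrite /height (bigD1 y) // [X in (_ < X)%N](bigD1 y) // tpermR.
have [-> ->] : nat_of_ord (x - i) = l /\ nat_of_ord (y - i) = l.+1.
  by rewrite !offE // ltnW.
rewrite -addSn leq_add2l leq_sum // => z /andP[zv zy].
by rewrite tpermD // eq_sym //; apply: contraNneq zv => ->.
Qed.

Lemma sum_pairs (F : nat -> nat) m :
  (\sum_(0 <= k0 < 2 * m) F k0 = \sum_(s < m) (F (2 * s) + F (2 * s).+1))%N.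
Proof.
elim: m => [|m IH]; first by rewrite big_geq // big_ord0.
by rewrite big_ord_recr /= -IH mulnS !big_nat_recr //= addnA.
Qed.

(** Cut the word from [i] into pairs of letters. If [i + 1] is top, the excluded factors [++-] and
    [+--] carry a plus sign from each even offset to the next, so every pair has at least one plus,
    hence exactly one. If [i + 1] is bottom, there are too few plus signs in total. *)
Lemma alternating_word i v :
  i \notin desbar v -> i + 1 \notin desbar v -> i - 1 \notin desbar v ->
  (forall l, (2 <= l)%N -> (l.+2 < n)%N -> ~~ [&& i + l%:R \in trow v 0,
     i + l.+1%:R \in trow v 0 & i + l.+2%:R \notin trow v 0]) ->
  (forall l, (2 <= l)%N -> (l.+2 < n)%N -> ~~ [&& i + l%:R \in trow v 0,
     i + l.+1%:R \notin trow v 0 & i + l.+2%:R \notin trow v 0]) ->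
  forall s : nat, (0 < s < a)%N ->
    (i + (2 * s)%:R \in trow v 0) && (i + (2 * s).+1%:R \notin trow v 0).
Proof.
pose w l := i + l%:R \in trow v 0; rewrite !desbarE // subrK.
have wn : w n = w 0%N by rewrite /w pchar_Zp.
have -> : (i \in trow v 0) = w 0%N by rewrite /w addr0.
have -> : (i + 1 \in trow v 0) = w 1%N by [].
have -> : (i + 1 + 1 \in trow v 0) = w 2%N by rewrite -addrA.
have -> : (i - 1 \in trow v 0) = w n.-1.
  by rewrite /w -subn1 natrB 1?ltnW // pchar_Zp // sub0r.
move=> w01 w12 wl0 noA noB.
have {}noA l : (2 <= l)%N -> (l.+2 < n)%N -> ~~ [&& w l, w l.+1 & ~~ w l.+2].
  exact: noA.
have {}noB l : (2 <= l)%N -> (l.+2 < n)%N -> ~~ [&& w l, ~~ w l.+1 & ~~ w l.+2].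
  exact: noB.
have wtotal : (\sum_(s < a) (w (2 * s) + w (2 * s).+1) = a)%N.
  by rewrite -(sum_pairs (fun l => w l : nat)) -card_shift // card_trow0.
have [w1|w1] := boolP (w 1%N).
  have w2 : w 2%N by move: w12; rewrite w1 negbK.
  have ev (s : nat) : (s.+1 < a)%N -> w (2 * s.+1)%N.
    elim: s => // s IH sa; have := IH (ltnW sa).
    have := noA (2 * s.+1)%N; have := noB (2 * s.+1)%N.
    rewrite (_ : (2 * s.+2) = (2 * s.+1).+2)%N; last by clear; lia.
    have b1 : (2 <= 2 * s.+1)%N by clear; lia.
    have b2 : ((2 * s.+1).+2 < n)%N by move: sa; rewrite /n; clear; lia.
    by move=> /(_ b1 b2) + /(_ b1 b2); do 3!case: (w _) => //=.
  have ge1 (s : 'I_a) : (1 <= w (2 * s) + w (2 * s).+1)%N.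
    case: s => -[|s] sa /=; first by rewrite w1 addn1.
    by rewrite ev.
  case=> // s /andP[s0 sa]; rewrite -[X in X && _]/(w _) -[X in _ && ~~ X]/(w
    _) ev //=.
  have : (\sum_(s < a) (w (2 * s) + w (2 * s).+1 - 1) = 0)%N.
    by rewrite sumnB // wtotal sum_nat_const card_ord muln1 subnn.
  move/eqP; rewrite sum_nat_eq0 => /forallP/(_ (Ordinal sa)) /=.
  by rewrite ev //; case: (w _).
have w0 : w 0%N = false by move: w01; rewrite w1 andbT => /negbTE.
have wn1 : w n.-1 = false by move: wl0; rewrite w0 andbT => /negbTE.
(* Backwards from offset [n - 1]: a plus two places before a minus would start an excluded factor.
   So each pair has at most one plus, and the pair at [i] has none. *)
have od (s : nat) : (s < a)%N -> w (2 * (a - s.+1)).+1 = false.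
  elim: s => [|s IH] sa.
    by rewrite -wn1; congr w; rewrite /n; move: a1; clear; lia.
  have [->|s0] := eqVneq (2 * (a - s.+2))%N 0%N; first exact: negbTE.
  set l := (2 * (a - s.+2))%N in s0 *.
  have b1 : (2 <= l.+1)%N by move: s0; clear; lia.
  have b2 : (l.+3 < n)%N by rewrite /l /n; move: sa; clear; lia.
  have w3 : w l.+3 = false.
    by rewrite -(IH (ltnW sa)); congr w; rewrite /l; move: sa; clear; lia.
  have := noA _ b1 b2; have := noB _ b1 b2.
  by rewrite w3; do 2!case: (w _) => //=.
have : (\sum_(s < a) (w (2 * s) + w (2 * s).+1) < a)%N.
  have a0 : (0 < a)%N by apply: ltnW.
  rewrite (bigD1 (Ordinal a0)) //= w0 (negbTE w1) add0n.
  rewrite -[X in (_ < X)%N]card_ord -[X in (_ < X)%N]sum1_card.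
  rewrite [X in (_ < X)%N](bigD1 (Ordinal a0)) //= add1n ltnS.
  apply: leq_sum => s _.
  have -> : (2 * s).+1 = (2 * (a - (a - s.+1).+1)).+1.
    by have := ltn_ord s; clear; lia.
  rewrite od ?addn0 ?leq_b1 //; have := ltn_ord s; clear; lia.
by rewrite wtotal ltnn.
Qed.

(** [compat] passes the descents at even offsets from [v] to every contributing [u], which fixes the
    top row of [u]. *)
Lemma desc_weight_alternating i v : i \notin desbar v ->
  (forall s : nat, (0 < s < a)%N ->
     (i + (2 * s)%:R \in trow v 0) && (i + (2 * s).+1%:R \notin trow v 0)) ->
  (desc_weight i v <= 1)%N.
Proof.
move=> iv alt; have [s0 is0 [_ s0v]] := desc_weight_edge iv.
have alt_in u (s : nat) : i \in desbar u -> (0 < k u v)%N -> (s < a)%N ->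
    (i + (2 * s)%:R \in trow u 0) && (i + (2 * s).+1%:R \notin trow u 0).
  move=> iu kuv sa; have dE x : (i + x%:R \in trow u 0) && (i + x.+1%:R \notin
    trow u 0)
      = (i + x%:R \in desbar u) by rewrite desbarE // -addrA natr1.
  rewrite dE; case: s sa => [|s] sa; first by rewrite addr0.
  have ln : (1 < 2 * s.+1 < n.-1)%N by rewrite /n; move: sa; clear; lia.
  have [neq cij] := cox_affA_far i ln; apply: contraTT kuv => ju.
  rewrite (compat neq cij iu ju iv) // desbarE // -addrA natr1; exact: alt.
have uniq u : i \in desbar u -> u != s0 -> k u v = 0%N.
  move=> iu us; apply/eqP; rewrite -leqn0 leqNgt; apply: contraNN us => kuv.
  apply/eqP/(trow0_inj a1)/setP => x; have [l ln ->] := shiftP n1 i x.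
  have la : (l./2 < a)%N by rewrite ltn_half_double -mul2n.
  have /andP[ue uo] := alt_in u _ iu kuv la.
  have /andP[se so] := alt_in s0 _ is0 (eq_leq (esym s0v)) la.
  have : l = (odd l + 2 * l./2)%N by rewrite mul2n odd_double_half.
  case: (odd l); rewrite ?add1n ?add0n => lE.
    by rewrite {1 2}lE (negPf uo) (negPf so).
  by rewrite {1 2}lE ue se.
by rewrite /desc_weight (bigD1 s0) //= s0v big1 // => u /andP[iu us];
  apply: uniq.
Qed.

(** Induction on [height i v]: a factor [++-] or [+--] at offsets 2 to [n - 1] admits a Knuth move
    lowering the height. *)
Lemma desc_weight_le1 i v : i \notin desbar v -> (desc_weight i v <= 1)%N.
Proof.
have [m] := ubnP (height i v); elim: m v => // m IH v hv iv.
have adjP : adjacent i (i + 1) by rewrite /adjacent eqxx.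
have adjN : adjacent i (i - 1) by rewrite /adjacent subrK eqxx orbT.
have [iP|iP] := boolP (i + 1 \in desbar v); first exact: desc_weight_bond iP.
have [iN|iN] := boolP (i - 1 \in desbar v); first exact: desc_weight_bond iN.
(* The letters [+-] at offsets [l], [l + 1] are exchanged and [p] is the offset of the descent
   gained: [l - 1] for [++-] becoming [+-+], [l + 1] for [+--] becoming [-+-]. The last premise
   gives the third letter of the factor. *)
have step l (p : nat) : (1 < l)%N -> (l.+1 < n)%N ->
    (p = l.-1 /\ 1 < l.-1 \/ p = l.+1 /\ l.+2 < n)%N ->
    i + l%:R \in trow v 0 -> i + l.+1%:R \notin trow v 0 ->
    i + (if p == l.+1 then l.+2 else l.-1)%:R \in trow v 0 = (p != l.+1) ->
    (desc_weight i v <= 1)%N.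
  move=> l1 ln pl lv lv1 pv.
  have [v' E] := exists_swap a1 v (i + l%:R) (i + l.+1%:R).
  have lS : i + l%:R + 1 = i + l.+1%:R by rewrite -addrA natr1.
  have E' := swap_sym E.
  have memv' x : (x < n)%N -> x != l -> x != l.+1 ->
      (i + x%:R \in trow v' 0) = (i + x%:R \in trow v 0).
    move=> xn xl xl1; rewrite (mem_swap _ E) tpermD // shift_eq // 1?eq_sym //.
    exact: ltnW.
  have lv' : i + l%:R \notin trow v' 0 by rewrite (mem_swap _ E) tpermL.
  have lv1' : i + l.+1%:R \in trow v' 0 by rewrite (mem_swap _ E) tpermR.
  have iv' : i \notin desbar v'.
    have v0 := memv' 0%N; have v1 := memv' 1%N; rewrite addr0 in v0.
    rewrite desbarE // v0 ?v1 -?desbarE //; by move: l1 ln; clear; lia.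
  have fk : i + l%:R \in desbar v /\ first_kind v v'.
    by apply: first_kind_swap; rewrite ?lS.
  have far x : (1 < x)%N -> (x.+1 < n)%N ->
      i != i + x%:R /\ cox i (i + x%:R) = 2%N.
    by move=> x1 xn; apply: cox_affA_far; move: x1 xn; clear; lia.
  have [ij cij] := far l l1 ln.
  have [p1 pn] : (1 < p /\ p.+1 < n)%N.
    by case: pl => -[-> ?]; split=> //; move: l1 ln; clear; lia.
  have [ip cip] := far p p1 pn.
  have [jv vv'] := fk.
  apply: (desc_weight_knuth ij cij ip cip _ jv _ iv iv' _).
  - rewrite /adjacent; case: pl => -[-> _]; rewrite -!addrA !natr1.
      by rewrite prednK ?eqxx ?orbT // ltnW.
    by rewrite eqxx.
  - rewrite desbarE // -addrA natr1; case: pl pv => -[-> pb]; rewrite ?eqxx.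
      rewrite ltn_eqF /=; last by move: l1; clear; lia.
      move=> pv; rewrite prednK 1?ltnW // lv' andbT memv' ?pv //;
        by move: l1 ln; clear; lia.
    move=> pv; rewrite lv1' memv' ?pv ?eqxx //; by move: l1 ln pb; clear; lia.
  - by apply: gamma_edge; rewrite vv'.
  - apply: IH => //; apply: leq_trans (height_swap ln lv lv1 E) _.
    by rewrite -ltnS.
have [/existsP[l /and5P[l1 ln lv lv1 lv2]]|noA] := boolP [exists l : 'I_n,
  [&& (1 < l)%N, (l.+2 < n)%N, i + l%:R \in trow v 0, i + l.+1%:R \in trow v 0
    & i + l.+2%:R \notin trow v 0]].
  by apply: (step l.+1 l) => //; [exact: ltnW|left|rewrite ltn_eqF].
have [/existsP[l /and5P[l1 ln lv lv1 lv2]]|noB] := boolP [exists l : 'I_n,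
  [&& (1 < l)%N, (l.+2 < n)%N, i + l%:R \in trow v 0,
    i + l.+1%:R \notin trow v 0
    & i + l.+2%:R \notin trow v 0]].
  by apply: (step l l.+1) => //; [exact: ltnW|right|rewrite eqxx;
    apply: negbTE].
apply: (desc_weight_alternating iv); apply: alternating_word => // l l1 ln.
- have ln' : (l < n)%N by move: ln; clear; lia.
  by move/existsPn/(_ (Ordinal ln')): noA; rewrite /= l1 ln.
- have ln' : (l < n)%N by move: ln; clear; lia.
  by move/existsPn/(_ (Ordinal ln')): noB; rewrite /= l1 ln.
Qed.

End DescentWeights.

(** * Bijectivity of the embedding and equality of all weights *)

(** The isomorphism puts the vertices of [H] in bijection with [V], so [f] becomes an injective
    self-map of a finite set. *)
Lemma embedding_bij (I : finType) (V : finType) (G H D : lgraph I) (c : V -> G)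
  (d : V -> D) (f : G -> H) : bijective c -> bijective d ->
  is_embedding f -> isomorphic (ugraph H) D -> bijective f.
Proof.
move=> [c' cK c'K] [d' dK d'K] [finj _ _] [g [[g' gK g'K] _ _]].
pose e (x : V) := d' (g (f (c x))).
have einj : injective e.
  move=> x y; rewrite /e => /(can_inj d'K)/(can_inj gK)/finj.
  by move/(can_inj cK).
have [e' eK e'K] := injF_bij einj.
exists (fun y => c (e' (d' (g y)))) => [x|y].
  by rewrite -[in RHS](c'K x) -(eK (c' x)) /e c'K.
by apply: (can_inj gK); apply: (can_inj d'K); apply: e'K.
Qed.

Theorem theorem9p10 (a : nat) (hn : (3 <= 2 * a)%N) (G : lgraph 'Z_(2 * a))
  (hW : wgraph (@cox_affA (2 * a)) G) (hred : reduced G) (hadm : nb_admissible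
    G)
  (hU : isomorphic (ugraph G) (Dgraph (2 * a) [:: a; a]))
  (f : Gammagraph (2 * a) [:: a; a] -> G) (hf : is_embedding f) :
  is_iso f.
Proof.
have a1 : (1 < a)%N by lia.
pose V := RSYT (2 * a) [:: a; a]; pose h : V -> G := f.
have hbij : bijective h.
  have idb : @bijective V V id by exists id.
  exact: (@embedding_bij _ V (Gammagraph _ _) G (Dgraph _ _) id id f idb idb).
have [_ ftau fwt] := hf.
have [k kE] : exists k : V -> V ->
  nat, forall u v, wt G (h u) (h v) = (k u v)%:R.
  have [k kE] := choice (fun p : V * V => hadm.1 (h p.1) (h p.2)).
  by exists (fun u v => k (u, v)) => u v; apply: (kE (u, v)).
have tauE u : tau G (h u) = desbar u by exact: ftau.
have gamma u v : first_kind u v || second_kind u v -> k u v = 1%N.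
  move=> uv; have := fwt u v; rewrite /= uv -!/(h _) kE => -[|/eqP].
    by move/esym/(@laurent_natr_inj _ 1).
  by rewrite oner_eq0.
have le1 i v : i \notin desbar v -> (desc_weight k i v <= 1)%N.
  apply: desc_weight_le1 => // {}i j ij cij u {}v.
  - have := wgraph_compatibility hW hbij kE ij cij; rewrite /= => H.
    by have := H u v; rewrite !tauE.
  - move=> iu ju iv jv; have := wgraph_polygon hW hbij kE ij cij (u := u) (v :=
    v).
    rewrite !tauE => /(_ iu ju iv jv).
    by under eq_bigl do rewrite !tauE; under [RHS]eq_bigl do rewrite !tauE.
  - move=> iu ju iv jv; have := wgraph_bonding hW hbij kE ij cij (u := u) (v :=
    v).
    rewrite !tauE => /(_ iu ju iv jv).
    by under eq_bigl do rewrite !tauE.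
split=> // u v; rewrite -!/(h _).
have [uv|uv] := boolP (first_kind u v || second_kind u v).
  by rewrite /= uv kE gamma.
have -> : wt (Gammagraph (2 * a) [:: a; a]) u v = 0 by rewrite /= (negbTE uv).
have [sub|/subsetPn[i iu iv]] := boolP (desbar u \subset desbar v).
  by apply: hred; rewrite !tauE.
(* The edge from [s] to [v] exhausts [N_i(v) <= 1], and [u] differs from [s] because there is no
   edge from [u] to [v] in the small graph. *)
have [s i_s [sv sv1]] := desc_weight_edge a1 gamma iv.
rewrite kE (desc_weight_uniq (le1 i v iv) i_s sv1 iu) //.
by apply: contraNneq uv => ->.
Qed.
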